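(* Let $q\ge2$, let $U$ be a $q\times q$ row-stochastic matrix (a DMC on $[1:q]$), and let $\Sigma_{n,U}$ denote the $n$-block noisy permutation channel built from $U$ (defined in the context). Logarithms are to base $2$. (i) (Achievability.) Let $r$ be the rank of $U$. There is a constant $c$ such that there exists a sequence of $\left(n,\left(\frac{n}{c\log n}\right)^{(r-1)/2},\lambda_{1,n},\lambda_{2,n}\right)$ ID codes for $\Sigma_{n,U}$ with deterministic encoders and deterministic decoders such that $\lambda_{1,n},\lambda_{2,n}\to0$ as $n\to\infty$. (ii) (Weak converse.) Assume all entries of $U$ are strictly positive. There exists a real number $R'$ such that for every $R>R'$, every sequence $(n_i)$ with $n_i\to\infty$ and every sequence of $\left(n_i, R\,n_i^{(q-1)/2}(\log n_i)^{(q-1)(q-2)/2},\lambda_{1,i},\lambda_{2,i}\right)$ ID codes with deterministic encoders and decoders for $\Sigma_{n_i,U}$, we have $\liminf_{i\to\infty}(\lambda_{1,i}+\lambda_{2,i})>0$. (iii) (Strong converse.) Assume all entries of $U$ are strictly positive. For any sequences $(n_i)$, $(c_i)$ with $n_i\to\infty$, $c_i\to\infty$, and any sequence of $\left(n_i, c_i\,n_i^{(q-1)/2}(\log n_i)^{(q-1)(q-2)/2},\lambda_{1,i},\lambda_{2,i}\right)$ ID codes with deterministic encoders and decoders for $\Sigma_{n_i,U}$, we have $\liminf_{i\to\infty}(\lambda_{1,i}+\lambda_{2,i})\ge1$.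
   Context: Noisy permutation channel $\Sigma_{n,U}$: input $\mathbf{x}\in[1:q]^n$; a permutation $\sigma$ of $[1:n]$ is drawn uniformly at random, $z_i=x_{\sigma^{-1}(i)}$, and each $z_i$ passes independently through $U$, giving output $\mathbf{y}\in[1:q]^n$; i.e. $P_\Sigma(\mathbf{y}|\mathbf{x})=\frac1{n!}\sum_{\sigma}\prod_i U(y_i|x_{\sigma^{-1}(i)})$. ID codes: an $L$-sized ID code for a channel $P(y|x)$ from $\mathcal{A}$ to $\mathcal{B}$ with deterministic decoders is $\{(Q_i,\mathcal{D}_i)\}_{i=1}^L$ with $Q_i$ a distribution on $\mathcal{A}$ and $\mathcal{D}_i\subseteq\mathcal{B}$; it has a deterministic encoder if every $Q_i$ is a point mass (at a codeword $\mathbf{x}_i$). Error probabilities: $\lambda_{i\to j}=\sum_x Q_i(x)\sum_{y\in\mathcal{D}_j}P(y|x)$ ($i\ne j$), $\lambda_{i\not\to i}=\sum_xQ_i(x)\sum_{y\notin\mathcal{D}_i}P(y|x)$, $\lambda_1=\max_i\lambda_{i\not\to i}$, $\lambda_2=\max_{i\ne j}\lambda_{i\to j}$. An $(n,L,\lambda_1,\lambda_2)$ ID code for $\Sigma_{n,U}$ is an $L$-sized ID code for $\Sigma_{n,U}$ with these error probabilities. *)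

(* Defs.v *)
From HB Require Import structures.
From mathcomp Require Import all_boot all_order all_algebra all_fingroup.
From mathcomp Require Import all_classical all_reals all_analysis.
Set Implicit Arguments. Unset Strict Implicit. Unset Printing Implicit Defensive.
Import Order.TTheory GRing.Theory Num.Theory.
Local Open Scope ring_scope.

Definition log2 {R : realType} (x : R) : R := ln x / ln 2.

Definition row_stochastic {R : realType} (q : nat) (U : 'M[R]_q) : Prop :=
  (forall a b, 0 <= U a b) /\ (forall a, \sum_(b < q) U a b = 1).

Definition word (q n : nat) := {ffun 'I_n -> 'I_q}.

Definition permch {R : realType} (q n : nat) (U : 'M[R]_q)
    (x y : word q n) : R :=
  (n`!%:R)^-1 * \sum_(s : 'S_n) \prod_(i < n) U (x ((s^-1)%g i)) (y i).

Record idcode (A B : finType) (L : nat) := IdCode {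
  enc : 'I_L -> A;
  dec : 'I_L -> {set B} }.

Section Errors.
Context {R : realType} {A B : finType} {L : nat}.
Variables (W : A -> B -> R) (C : idcode A B L).

Definition lam_cross (i j : 'I_L) : R := \sum_(y in dec C j) W (enc C i) y.
Definition lam_miss (i : 'I_L) : R := \sum_(y in ~: dec C i) W (enc C i) y.
Definition lambda1 : R := \big[Num.max/0]_(i < L) lam_miss i.
Definition lambda2 : R :=
  \big[Num.max/0]_(i < L) \big[Num.max/0]_(j < L | j != i) lam_cross i j.
End Errors.

(* Main.v *)
(** Summing [permch U x] over a set [D] gives the mean, under the product law
    [prod_i U (x i) (y i)], of the symmetric function [orbit_freq D], which takes
    [y] to the fraction of permutations that bring it into [D].

    Achievability: take letters [base] and [a l] whose rows are affinely
    independent, and let codewords use the letter [a l] a multiple of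
    [s ~ sqrt (n log n)] times.  The expected output counts of two codewords are
    then more than [2 sqrt (n log n)] apart in some coordinate, whereas by
    Chebyshev the counts deviate by [sqrt (n log n)] with probability
    [O (1 / log n)].

    Converse: two codewords whose means of a symmetric test function differ by at
    most [e] force [lambda1 + lambda2 >= 1 - e].  Changing one input letter moves
    such a mean by [O (1 / sqrt n)], so it is enough that the two words can be
    permuted to differ in few positions.  Sorted words differ in few positions as
    soon as their cumulative letter counts are close, and rounding the [q - 1]
    cumulative counts to multiples of [s ~ e sqrt n] leaves [O (n ^ ((q - 1) / 2))]
    cells. *)
Require Import Defs.
From HB Require Import structures.
From mathcomp Require Import all_boot all_order all_algebra all_fingroup.
From mathcomp Require Import ring lra zify.
From mathcomp Require Import all_classical all_reals all_analysis.
Set Implicit Arguments. Unset Strict Implicit. Unset Printing Implicit Defensive.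
Import Order.TTheory GRing.Theory Num.Theory numFieldNormedType.Exports.
Local Open Scope ring_scope.

(** * Product laws and symmetrisation *)

Lemma prod_expectation (R : realType) (q n : nat) (p h : 'I_n -> 'I_q -> R) :
  \sum_(y : word q n) (\prod_i p i (y i)) * \prod_i h i (y i) =
  \prod_i \sum_b p i b * h i b.
Proof.
rewrite bigA_distr_bigA; apply: eq_bigr => y _.
by rewrite big_split.
Qed.

Lemma prod_sum1 (R : realType) (q n : nat) (p : 'I_n -> 'I_q -> R) :
  (forall i, \sum_b p i b = 1) ->
  \sum_(y : word q n) \prod_i p i (y i) = 1.
Proof.
by move=> p1; rewrite -bigA_distr_bigA; apply: big1 => i _; rewrite p1.
Qed.

(** Independence factors the mean over positions; off the diagonal the factor at [i] is the mean of
    [h i], which vanishes. *)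
Lemma prod_pair_moment (R : realType) (q n : nat) (p h : 'I_n -> 'I_q -> R)
    (i j : 'I_n) :
  (forall i, \sum_b p i b = 1) -> (forall i, \sum_b p i b * h i b = 0) ->
  \sum_(y : word q n) (\prod_i p i (y i)) * (h i (y i) * h j (y j)) =
  if i == j then \sum_b p i b * h i b ^+ 2 else 0.
Proof.
move=> p1 h0.
(* Padding with factors 1 turns the pair into a product over all positions; when [i = j] both
   factors fall on [i] and give the square. *)
pose g k b := (if k == i then h k b else 1) * (if k == j then h k b else 1).
transitivity (\sum_(y : word q n) (\prod_i p i (y i)) * \prod_i g i (y i)).
  apply: eq_bigr => y _; congr (_ * _); rewrite big_split /=.
  have prod_one k0 : \prod_k (if k == k0 then h k (y k) else 1) = h k0 (y k0).
    by rewrite -big_mkcond big_pred1_eq.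
  by rewrite !prod_one.
rewrite prod_expectation (bigD1 i) //= {}/g.
have [<-|_] := eqVneq i j.
  rewrite [X in _ * X]big1 ?mulr1 => [|k ki].
    by apply: eq_bigr => b _; rewrite eqxx.
  by rewrite (negPf ki) -[RHS](p1 k); apply: eq_bigr => b _; rewrite !mulr1.
rewrite [X in X * _](_ : _ = 0) ?mul0r // -[RHS](h0 i); apply: eq_bigr => b _.
by rewrite eqxx mulr1.
Qed.

Lemma prod_second_moment (R : realType) (q n : nat)
    (p h : 'I_n -> 'I_q -> R) (A : {set 'I_n}) :
  (forall i, \sum_b p i b = 1) -> (forall i, \sum_b p i b * h i b = 0) ->
  \sum_(y : word q n) (\prod_i p i (y i)) * (\sum_(i in A) h i (y i)) ^+ 2 =
  \sum_(i in A) \sum_b p i b * h i b ^+ 2.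
Proof.
move=> p1 h0.
transitivity (\sum_(i in A) \sum_(j in A) \sum_(y : word q n)
    (\prod_i p i (y i)) * (h i (y i) * h j (y j))).
  under [RHS]eq_bigr do rewrite exchange_big.
  rewrite exchange_big; apply: eq_bigr => y _.
  rewrite expr2 mulr_suml mulr_sumr; apply: eq_bigr => i _.
  by rewrite !mulr_sumr.
apply: eq_bigr => i iA; under eq_bigr do rewrite prod_pair_moment //.
rewrite (bigD1 i) //= eqxx [X in _ + X]big1 ?addr0 // => j /andP[_ ji].
by rewrite eq_sym (negPf ji).
Qed.

Definition word_perm (q n : nat) (s : 'S_n) (y : word q n) : word q n :=
  [ffun i => y (s i)].

Lemma word_permM (q n : nat) (s t : 'S_n) (y : word q n) :
  word_perm s (word_perm t y) = word_perm (s * t) y.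
Proof. by apply/ffunP => i; rewrite !ffunE permM. Qed.

Lemma word_permK (q n : nat) (s : 'S_n) :
  cancel (@word_perm q n s) (word_perm s^-1).
Proof. by move=> y; apply/ffunP => i; rewrite !ffunE permKV. Qed.

Lemma word_permKV (q n : nat) (s : 'S_n) :
  cancel (@word_perm q n s^-1) (word_perm s).
Proof. by move=> y; apply/ffunP => i; rewrite !ffunE permK. Qed.

Definition symmetric_fun (R : realType) (q n : nat) (g : word q n -> R) :=
  forall s y, g (word_perm s y) = g y.

Definition mean_under (R : realType) (q n : nat) (U : 'M[R]_q)
    (x : word q n) (g : word q n -> R) : R :=
  \sum_(y : word q n) (\prod_i U (x i) (y i)) * g y.

Definition orbit_freq (R : realType) (q n : nat) (D : {set word q n})
    (y : word q n) : R :=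
  (n`!%:R)^-1 * \sum_(s : 'S_n) (word_perm s^-1 y \in D)%:R.

Section SymmetrisedChannel.
Variables (R : realType) (q n : nat) (U : 'M[R]_q).
Implicit Types (x y : word q n) (D : {set word q n}) (g : word q n -> R).

(** For each permutation, relabelling the output moves the permutation from the input word onto the
    test set. *)
Lemma permch_sum x D :
  \sum_(y in D) permch U x y = mean_under U x (orbit_freq R D).
Proof.
rewrite /permch -mulr_sumr /mean_under /orbit_freq.
under [RHS]eq_bigr do rewrite mulrCA mulr_sumr.
rewrite -mulr_sumr; congr (_ * _).
rewrite exchange_big [RHS]exchange_big; apply: eq_bigr => s _ /=.
rewrite [RHS](reindex (word_perm s)); last first.
  by apply: onW_bij; exists (word_perm s^-1); [exact: word_permK|exact: word_permKV].
rewrite big_mkcond; apply: eq_bigr => y _; rewrite word_permK.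
case: ifP => _; rewrite ?mulr0 // mulr1 [LHS](reindex_inj (@perm_inj _ s)) /=.
by apply: eq_bigr => i _; rewrite permK ffunE.
Qed.

Lemma orbit_freq_sym D : symmetric_fun (orbit_freq R D).
Proof.
move=> s y; rewrite /orbit_freq; congr (_ * _).
rewrite (reindex_inj (mulgI s)) /=; apply: eq_bigr => t _.
by rewrite word_permM invMg mulgKV.
Qed.

Lemma mean_under_perm x g (s : 'S_n) : symmetric_fun g ->
  mean_under U (word_perm s x) g = mean_under U x g.
Proof.
move=> gs; rewrite /mean_under [LHS](reindex (word_perm s)); last first.
  by apply: onW_bij; exists (word_perm s^-1); [exact: word_permK|exact: word_permKV].
apply: eq_bigr => y _; rewrite gs; congr (_ * _).
rewrite [RHS](reindex_inj (@perm_inj _ s)) /=.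
by apply: eq_bigr => i _; rewrite !ffunE.
Qed.

Hypothesis Ustoch : row_stochastic U.

Lemma mean_under_cst x c : mean_under U x (fun=> c) = c.
Proof.
rewrite /mean_under -mulr_suml (@prod_sum1 _ _ _ (fun i => U (x i))) ?mul1r //.
by move=> i; exact: (proj2 Ustoch).
Qed.

Lemma orbit_freq_ge0 D y : 0 <= orbit_freq R D y.
Proof.
by rewrite mulr_ge0 ?invr_ge0 ?ler0n // sumr_ge0.
Qed.

Lemma orbit_freqC D y : orbit_freq R (~: D) y = 1 - orbit_freq R D y.
Proof.
rewrite /orbit_freq; apply/eqP; rewrite eq_sym subr_eq eq_sym -mulrDr -big_split /=.
rewrite (eq_bigr (fun=> 1)) => [|s _]; last by rewrite inE; case: (_ \in D); rewrite ?addr0 ?add0r.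
by rewrite sumr_const card_Sn mulVf // pnatr_eq0 -lt0n fact_gt0.
Qed.

Lemma orbit_freq_le1 D y : orbit_freq R D y <= 1.
Proof. by rewrite -subr_ge0 -orbit_freqC orbit_freq_ge0. Qed.

Lemma permch_miss x D :
  \sum_(y in ~: D) permch U x y = 1 - mean_under U x (orbit_freq R D).
Proof.
rewrite permch_sum -[in RHS](mean_under_cst x 1) -sumrB.
by apply: eq_bigr => y _; rewrite -mulrBr orbit_freqC.
Qed.

End SymmetrisedChannel.

(** * Dependence of symmetric means on the input *)

Definition set_letter (q n : nat) (i : 'I_n) (a : 'I_q) (x : word q n) :
    word q n :=
  [ffun k => if k == i then a else x k].

Lemma set_letter_set (q n : nat) (i : 'I_n) (a b : 'I_q) (x : word q n) :
  set_letter i a (set_letter i b x) = set_letter i a x.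
Proof. by apply/ffunP => k; rewrite !ffunE; case: eqVneq. Qed.

Lemma set_letter_id (q n : nat) (i : 'I_n) (x : word q n) :
  set_letter i (x i) x = x.
Proof. by apply/ffunP => k; rewrite ffunE; case: eqVneq => [->|]. Qed.

(** This makes positions with equal letters interchangeable: a symmetric mean cannot tell at which
    of them the substitution took place. *)
Lemma set_letter_tperm (q n : nat) (i j : 'I_n) (a : 'I_q) (w : word q n) :
  w i = w j -> word_perm (tperm i j) (set_letter i a w) = set_letter j a w.
Proof.
move=> wij; apply/ffunP => k; rewrite !ffunE.
case: tpermP => [->|->|/eqP ki /eqP kj]; rewrite ?eqxx //.
  by rewrite eq_sym; case: eqVneq.
by rewrite (negPf ki) (negPf kj).
Qed.

(** The variance of [g * S] is nonnegative, and [g ^+ 2 <= 1]. *)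
Lemma sqr_mean_le (R : realFieldType) (T : finType) (P g S : T -> R) :
  (forall t, 0 <= P t) -> \sum_t P t = 1 -> (forall t, 0 <= g t <= 1) ->
  (\sum_t P t * (g t * S t)) ^+ 2 <= \sum_t P t * S t ^+ 2.
Proof.
move=> P0 P1 g01; set m := \sum_t _.
have : 0 <= \sum_t P t * (g t * S t - m) ^+ 2.
  by apply: sumr_ge0 => t _; rewrite mulr_ge0 ?sqr_ge0.
have -> : \sum_t P t * (g t * S t - m) ^+ 2 =
    \sum_t P t * (g t * S t) ^+ 2 - m ^+ 2.
  transitivity (\sum_t (P t * (g t * S t) ^+ 2 - 2 * m * (P t * (g t * S t))
      + P t * m ^+ 2)).
    by apply: eq_bigr => t _; ring.
  by rewrite big_split sumrB /= -mulr_sumr -mulr_suml P1 -/m; ring.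
rewrite subr_ge0 => /le_trans; apply; apply: ler_sum => t _.
rewrite ler_wpM2l // exprMn ler_piMl ?sqr_ge0 //.
by have /andP[g0 g1] := g01 t; rewrite expr_le1.
Qed.

Lemma popular_letter (q n : nat) (x : word q n) : (0 < n)%N ->
  exists a, (n <= q * #|[set i | x i == a]|)%N.
Proof.
move=> n0; pose a1 := x (Ordinal n0).
exists [arg max_(a > a1) #|[set i | x i == a]|]%N.
case: arg_maxnP => // a _ amax.
have {1}-> : n = (\sum_(b < q) #|[set i | x i == b]|)%N.
  rewrite -[LHS](card_ord n) -sum1_card (partition_big x xpredT) //=.
  by apply: eq_bigr => b _; rewrite -sum1_card; apply: eq_bigl => i; rewrite inE.
apply: (@leq_trans (\sum_(b < q) #|[set i | x i == a]|)%N).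
  by apply: leq_sum => b _; exact: amax.
by rewrite sum_nat_const card_ord.
Qed.

Section PositiveChannel.
Variables (R : realType) (q n : nat) (U : 'M[R]_q) (u : R).
Hypotheses (Ustoch : row_stochastic U) (u_gt0 : 0 < u).
Hypothesis (Uu : forall a b, u <= U a b).
Implicit Types (x w : word q n) (g : word q n -> R).

Let U_gt0 a b : 0 < U a b.
Proof. exact: lt_le_trans u_gt0 (Uu a b). Qed.

(** Likelihood ratio: the denominator cancels the factor of the product law at [i], and the
    numerator puts the rows of [a] and [b] there. *)
Lemma mean_under_score w g (i : 'I_n) (a b : 'I_q) :
  mean_under U w (fun y => g y * ((U a (y i) - U b (y i)) / U (w i) (y i))) =
  mean_under U (set_letter i a w) g - mean_under U (set_letter i b w) g.
Proof.
rewrite /mean_under -sumrB; apply: eq_bigr => y _.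
have subst_prod c : \prod_k U (set_letter i c w k) (y k) =
    U c (y i) * \prod_(k | k != i) U (w k) (y k).
  rewrite (bigD1 i) //= ffunE eqxx; congr (_ * _).
  by apply: eq_bigr => k /negPf ki; rewrite ffunE ki.
rewrite !subst_prod (bigD1 i) //=.
by field; rewrite gt_eqF.
Qed.

(** Entries lie in [0, 1], so the squared difference is at most [U a d + U b d]; the denominators
    are at least [u], and two rows sum to 2. *)
Lemma score_variance (a b c : 'I_q) :
  \sum_d U c d * ((U a d - U b d) / U c d) ^+ 2 <= 2 / u.
Proof.
have Ule1 e d : U e d <= 1.
  rewrite -(proj2 Ustoch e) (bigD1 d) //= lerDl sumr_ge0 // => k _.
  exact: (proj1 Ustoch).
apply: (@le_trans _ _ (\sum_d (U a d + U b d) / u)); last first.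
  by rewrite -mulr_suml big_split /= !(proj2 Ustoch).
apply: ler_sum => d _.
have -> : U c d * ((U a d - U b d) / U c d) ^+ 2 = (U a d - U b d) ^+ 2 / U c d.
  by field; rewrite gt_eqF.
apply: ler_pM; rewrite ?sqr_ge0 ?invr_ge0 ?(ltW (U_gt0 _ _)) //; last first.
  by rewrite lef_pV2 ?posrE.
have := Ule1 a d; have := Ule1 b d; have := U_gt0 a d; have := U_gt0 b d.
by nra.
Qed.

(* Substituting the letter at a position of [I] is, to first order, tilting by
   the score [h]; symmetry of [g] makes all positions of [I] equivalent, so the
   sum of [#|I|] scores has a mean of order [#|I|] times the difference while
   its standard deviation is only of order [sqrt #|I|]. *)
Lemma mean_under_step x g (i0 : 'I_n) (a b : 'I_q) :
  symmetric_fun g -> (forall y, 0 <= g y <= 1) ->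
  (mean_under U (set_letter i0 a x) g - mean_under U (set_letter i0 b x) g) ^+ 2
  <= 2 * q%:R / u / n%:R.
Proof.
move=> gsym g01.
have n_gt0 : (0 < n)%N by apply: leq_trans (ltn_ord i0).
have [a0 na0] := popular_letter x n_gt0.
(* Overwriting position [i0] leaves both compared words unchanged and puts [i0] in [I]. *)
pose w := set_letter i0 a0 x; pose I := [set i | w i == a0].
have nI : (n <= q * #|I|)%N.
  apply: leq_trans na0 _; rewrite leq_mul2l subset_leq_card ?orbT //.
  by apply/fintype.subsetP => i; rewrite !inE ffunE; case: ifP.
pose h c := (U a c - U b c) / U a0 c.
set d := _ - _.
have meanE : mean_under U w (fun y => g y * \sum_(i in I) h (y i)) = #|I|%:R * d.
  transitivity (\sum_(i in I) d); last by rewrite sumr_const mulr_natl.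
  rewrite /mean_under; under eq_bigr do rewrite !mulr_sumr.
  rewrite exchange_big; apply: eq_bigr => i; rewrite inE => /eqP wi.
  have wi0 : w i0 = a0 by rewrite ffunE eqxx.
  have := mean_under_score w g i a b; rewrite wi {1}/mean_under => ->.
  (* The transposition carries the substitution from [i] to [i0], so every position of [I]
     contributes the same difference [d]. *)
  rewrite -(mean_under_perm U (set_letter i a w) (tperm i i0) gsym).
  rewrite -(mean_under_perm U (set_letter i b w) (tperm i i0) gsym).
  by rewrite !set_letter_tperm ?wi // !set_letter_set.
have I_gt0 : 0 < #|I|%:R :> R.
  by rewrite ltr0n; case: (#|I|) nI => //; rewrite muln0 leqNgt n_gt0.
have : (#|I|%:R * d) ^+ 2 <= #|I|%:R * (2 / u).
  rewrite -meanE; apply: le_trans (@sqr_mean_le _ _ _ _ _ _ _ g01) _.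
  - by move=> y; apply: prodr_ge0 => i _; exact: (proj1 Ustoch).
  - apply: (@prod_sum1 _ _ _ (fun i => U (w i))) => i; exact: (proj2 Ustoch).
  (* The score is centred under the row of [a0], hence on [I]; setting it to 0 elsewhere centres it
     at every position. *)
  pose h' i c := if i \in I then h c else 0.
  have hE y : \sum_(i in I) h (y i) = \sum_(i in I) h' i (y i).
    by apply: eq_bigr => i iI; rewrite /h' iI.
  under eq_bigr do rewrite hE.
  rewrite (@prod_second_moment _ _ _ (fun i => U (w i)) h'); last 2 first.
  - by move=> i; exact: (proj2 Ustoch).
  - move=> i; rewrite /h'; have [|_] := boolP (i \in I); last by apply: big1 => c _; rewrite mulr0.
    rewrite inE => /eqP ->; rewrite -[RHS](subrr 1).
    rewrite -[X in X - _](proj2 Ustoch a) -[X in _ - X](proj2 Ustoch b) -sumrB.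
    by apply: eq_bigr => c _; rewrite /h; field; rewrite gt_eqF.
  rewrite mulr_natl -sumr_const; apply: ler_sum => i iI; rewrite /h' iI.
  by move: iI; rewrite inE => /eqP ->; exact: score_variance.
rewrite exprMn expr2 -mulrA ler_pM2l // mulrC -ler_pdivlMr // => /le_trans; apply.
rewrite -[leLHS]mulr1 -mulrA ler_pdivlMr ?ltr0n // .
have -> : 2 / u * (#|I|%:R^-1 * 1) * n%:R = (2 / u) * (n%:R / #|I|%:R) by ring.
have -> : 2 * q%:R / u = (2 / u) * q%:R by ring.
rewrite ler_pM2l ?divr_gt0 // ler_pdivrMr // -natrM ler_nat //.
Qed.

Definition hamming x x' : nat := \sum_(i < n) (x i != x' i).

(** Telescoping over hybrids [z k], whose first [k] letters come from [x']: each disagreement costs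
    one letter change, agreements cost nothing. *)
Lemma mean_under_hamming x x' g :
  symmetric_fun g -> (forall y, 0 <= g y <= 1) ->
  `|mean_under U x g - mean_under U x' g|
  <= (hamming x x')%:R * Num.sqrt (2 * q%:R / u / n%:R).
Proof.
move=> gsym g01; set kappa := Num.sqrt _.
pose z (k : nat) : word q n := [ffun i : 'I_n => if (i < k)%N then x' i else x i].
have z0 : z 0%N = x by apply/ffunP => i; rewrite ffunE.
have zn : z n = x' by apply/ffunP => i; rewrite ffunE ltn_ord.
rewrite distrC -{1}z0 -{1}zn -(telescope_sumr (fun k => mean_under U (z k) g)) //.
rewrite big_mkord (le_trans (ler_norm_sum _ _ _)) // /hamming natr_sum mulr_suml.
apply: ler_sum => i _.
have zi : z i = set_letter i (x i) (z i).
  by rewrite -[in RHS](_ : z i i = x i) ?set_letter_id // ffunE ltnn.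
have zi1 : z i.+1 = set_letter i (x' i) (z i).
  apply/ffunP => k; rewrite !ffunE ltnS leq_eqVlt.
  by have [->|] := eqVneq k i; rewrite ?eqxx // => /negPf; rewrite -val_eqE /= => ->.
rewrite zi1 [in X in _ - X]zi; case: (eqVneq (x i) (x' i)) => [->|_] /=.
  by rewrite subrr normr0 mul0r.
by rewrite mul1r -sqrtr_sqr ler_wsqrtr // mean_under_step.
Qed.

End PositiveChannel.

(** * Converse *)

(** The unnormalised distribution function of the letters of [x]; it equals [n] from [a = q - 1] on,
    so [q - 1] values determine it. *)
Definition cumcount (q n : nat) (x : word q n) (a : nat) : nat :=
  #|[set i | (x i <= a)%N]|.

(** The permutation sorts [x]. In threshold form, each set of letters at most [a] occupies an
    initial segment of positions. *)
Lemma exists_sorted_word (q n : nat) (x : word q n) :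
  exists s : 'S_n, forall (a : nat) (i : 'I_n),
    (word_perm s x i <= a)%N = (i < cumcount x a)%N.
Proof.
pose t := [tuple x i | i < n].
pose st := sort (fun a b : 'I_q => (a <= b)%N) t.
have st_perm : perm_eq st t by rewrite perm_sort.
have [s stE] := tuple_permP st_perm.
exists s => a i.
have size_st : size (map val st) = n by rewrite size_map (perm_size st_perm) size_tuple.
have nthE : nth 0%N (map val st) i = word_perm s x i.
  rewrite stE (nth_map (x i)) ?size_tuple // -[nth _ _ _]/(nth _ (val _) i).
  by rewrite -tnth_nth !tnth_mktuple ffunE.
have st_sorted : sorted <=%O (map val st).
  rewrite sorted_map; apply: (@sort_sorted _ (fun a b : 'I_q => (a <= b)%N)).
  by move=> b c; exact: leq_total.
have countE : count (<= a)%O (map val st) = cumcount x a.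
  rewrite count_map (seq.permP st_perm) /= count_map /cumcount cardsE cardE size_filter.
  by rewrite enumT; apply: eq_count => j.
rewrite -nthE -countE; case: ltnP => hi; first exact: (nth_count_le 0%N st_sorted hi).
by apply/negbTE; rewrite -ltnNge; apply: (nth_count_gt 0%N st_sorted); rewrite hi size_st ltn_ord.
Qed.

(** Two initial segments differ on the interval between their ends; the two truncated subtractions
    add up to the distance of [N] and [N']. *)
Lemma card_ltn_neq (n N N' : nat) :
  (\sum_(i < n) ((i < N) != (i < N')) <= (N - N') + (N' - N))%N.
Proof.
wlog NN' : N N' / (N <= N')%N => [hwlog|].
  have [|/ltnW] := leqP N N'; first exact: hwlog.
  move=> /hwlog; rewrite addnC; under eq_bigr do rewrite eq_sym; exact.
rewrite -(big_mkord xpredT (fun i => nat_of_bool ((i < N) != (i < N'))%N)) /=.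
rewrite (eq_bigr (fun i => nat_of_bool (i \in iota N (N' - N)))); last first.
  by move=> i _; rewrite mem_iota subnKC //; congr nat_of_bool; lia.
rewrite -big_mkcond /= sum1_count -size_filter.
apply: leq_trans (leq_addl _ _); rewrite -[leqRHS](size_iota N).
apply: uniq_leq_size => [|i]; first by rewrite filter_uniq ?iota_uniq.
by rewrite mem_filter => /andP[].
Qed.

Lemma hamming_sorted (q n : nat) (x x' : word q n) (s s' : 'S_n) :
  (forall a i, (word_perm s x i <= a)%N = (i < cumcount x a)%N) ->
  (forall a i, (word_perm s' x' i <= a)%N = (i < cumcount x' a)%N) ->
  (hamming (word_perm s x) (word_perm s' x') <=
   \sum_(a < q.-1) ((cumcount x a - cumcount x' a)
                    + (cumcount x' a - cumcount x a)))%N.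
Proof.
move=> xs xs'.
apply: (@leq_trans (\sum_(a < q.-1) \sum_(i < n)
    ((i < cumcount x a) != (i < cumcount x' a)))%N); last first.
  by apply: leq_sum => a _; exact: card_ltn_neq.
rewrite exchange_big; apply: leq_sum => i _.
set z := word_perm s x i; set z' := word_perm s' x' i.
have [//|zz'] := eqVneq z z'.
(* The smaller of the two letters is a threshold separating them, and it lies below [q.-1] because
   the other letter is larger. *)
have [a aq] : exists2 a, (a < q.-1)%N & ((z <= a) != (z' <= a))%N.
  have := ltn_ord z; have := ltn_ord z'.
  have : (z != z' :> nat) by [].
  rewrite neq_ltn => /orP[lt|lt] ? ?; [exists (z : nat)|exists (z' : nat)]; lia.
rewrite /z /z' xs xs' => ne; rewrite (bigD1 (Ordinal aq)) //= ne; exact: leq_addr.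
Qed.

Section Converse.
Variables (R : realType) (q : nat) (U : 'M[R]_q) (u : R).
Hypotheses (q_gt0 : (0 < q)%N) (Ustoch : row_stochastic U) (u_gt0 : 0 < u).
Hypothesis (Uu : forall a b, u <= U a b).

(** Both words may be sorted because [g] is symmetric; counts with equal quotient by [s] differ by
    at most [s - 1] at each of the [q - 1] thresholds. *)
Lemma mean_under_cumcount (n s : nat) (x x' : word q n) (g : word q n -> R) :
  symmetric_fun g -> (forall y, 0 <= g y <= 1) -> (0 < s)%N ->
  (forall a, (a < q.-1)%N -> cumcount x a %/ s = cumcount x' a %/ s)%N ->
  `|mean_under U x g - mean_under U x' g|
  <= (q.-1 * s.-1)%:R * Num.sqrt (2 * q%:R / u / n%:R).
Proof.
move=> gsym g01 s_gt0 xx'.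
have [t xt] := exists_sorted_word x; have [t' xt'] := exists_sorted_word x'.
rewrite -(mean_under_perm U x t gsym) -(mean_under_perm U x' t' gsym).
apply: le_trans (mean_under_hamming Ustoch u_gt0 Uu _ _ gsym g01) _.
rewrite ler_wpM2r ?sqrtr_ge0 // ler_nat.
apply: leq_trans (hamming_sorted xt xt') _.
rewrite -[X in (_ <= X * _)%N]card_ord -sum_nat_const; apply: leq_sum => a _.
have := xx' a (ltn_ord a); move: (cumcount x a) (cumcount x' a) => N N' e.
have := divn_eq N s; have := divn_eq N' s; rewrite e.
by have := ltn_pmod N s_gt0; have := ltn_pmod N' s_gt0; lia.
Qed.

Lemma lam_miss_le_lambda1 (A B : finType) (W : A -> B -> R) (L : nat)
    (C : idcode A B L) i : lam_miss W C i <= lambda1 W C.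
Proof. exact: le_bigmax_cond. Qed.

Lemma lam_cross_le_lambda2 (A B : finType) (W : A -> B -> R) (L : nat)
    (C : idcode A B L) i j : j != i -> lam_cross W C i j <= lambda2 W C.
Proof.
by move=> ji; apply: bigmax_sup => //; exact: le_bigmax_cond.
Qed.

(** The error [i -> j] and the miss at [j] use the same test [dec C j]; with equal means they would
    sum to exactly 1. *)
Lemma lambda_sum_ge (n L : nat) (C : idcode (word q n) (word q n) L) i j d :
  i != j ->
  `|mean_under U (enc C i) (orbit_freq R (dec C j))
    - mean_under U (enc C j) (orbit_freq R (dec C j))| <= d ->
  1 - d <= lambda1 (permch U) C + lambda2 (permch U) C.
Proof.
move=> ij hd.
have := lam_miss_le_lambda1 (permch U) C j.
have := lam_cross_le_lambda2 (permch U) C (i := i) (j := j).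
rewrite eq_sym => /(_ ij); rewrite /lam_miss /lam_cross permch_sum permch_miss //.
by move: hd; rewrite ler_norml => /andP[]; lra.
Qed.

Lemma converse_bound (e : R) : 0 < e -> exists2 M : R, 0 < M &
  forall (n L : nat) (C : idcode (word q n) (word q n) L), (0 < n)%N ->
  M * Num.sqrt n%:R ^+ q.-1 < L%:R ->
  1 - e <= lambda1 (permch U) C + lambda2 (permch U) C.
Proof.
move=> e_gt0; pose K := Num.sqrt (2 * q%:R / u).
have q_gt0' : 0 < q%:R :> R by rewrite ltr0n.
have K_gt0 : 0 < K by rewrite sqrtr_gt0 divr_gt0 ?mulr_gt0.
(* With cell width about [e' * r], the drift inside a cell is at most [q * (e' * r) * K / r = e]. *)
pose e' := e / (K * q%:R).
have e'_gt0 : 0 < e' by rewrite divr_gt0 ?mulr_gt0.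
exists ((e'^-1 + 1) ^+ q.-1); first by rewrite exprn_gt0 // addr_gt0 ?invr_gt0.
move=> n L C n_gt0 L_gt; set r := Num.sqrt n%:R in L_gt.
have r_ge1 : 1 <= r by rewrite -sqrtr1 ler_wsqrtr // ler1n.
have r_gt0 : 0 < r by rewrite (lt_le_trans ltr01).
have rr : r ^+ 2 = n%:R by rewrite sqr_sqrtr.
(* The bound on [s.-1] controls the drift inside a cell, the bound on [s] the number of cells. *)
pose s := (Num.trunc (e' * r)).+1.
have s_le : s.-1%:R <= e' * r by rewrite /s /= truncn_le mulr_ge0 ?ltW.
have s_gt : e' * r < s%:R by exact: truncnS_gt.
pose cell (i : 'I_L) : {ffun 'I_q.-1 -> 'I_(n %/ s)%N.+1} :=
  [ffun a : 'I_q.-1 => inord (cumcount (enc C i) a %/ s)%N].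
(* Pigeonhole: each coordinate takes [n %/ s + 1 <= (e'^-1 + 1) * r] values, where [1 <= r] absorbs
   the extra cell. *)
have /injectivePn[i [j ij cij]] : ~~ injectiveb cell.
  apply/negP => /injectiveP /leq_card; rewrite card_ffun !card_ord leqNgt => /negP; apply.
  rewrite -(ltr_nat R); apply: le_lt_trans L_gt.
  rewrite natrX -exprMn; apply: lerXn2r; rewrite ?nnegrE ?ler0n //.
    by rewrite mulr_ge0 // ?addr_ge0 ?invr_ge0 // ltW.
  have : (n %/ s)%N%:R <= e'^-1 * r.
    apply: (@le_trans _ _ (n%:R / s%:R)).
      by rewrite ler_pdivlMr ?ltr0n // -natrM ler_nat leq_trunc_div.
    rewrite ler_pdivrMr ?ltr0n // -rr.
    have -> : r ^+ 2 = e'^-1 * r * (e' * r) by field; rewrite gt_eqF.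
    by rewrite ler_wpM2l ?(ltW s_gt) // mulr_ge0 ?invr_ge0 // ltW.
  by rewrite -natr1 mulrDl mul1r => h; exact: lerD.
apply: (lambda_sum_ge ij).
apply: le_trans (mean_under_cumcount _ _ (isT : (0 < s)%N) _) _.
- exact: orbit_freq_sym.
- by move=> y; rewrite orbit_freq_ge0 orbit_freq_le1.
- move=> a aq; have /ffunP/(_ (Ordinal aq)) := cij; rewrite !ffunE /= => /(congr1 val).
  have le_n k : (cumcount (enc C k) a %/ s < (n %/ s).+1)%N.
    by rewrite ltnS leq_div2r // -[leqRHS]card_ord max_card.
  by rewrite /= !inordK.
have K2_ge0 : 0 <= 2 * q%:R / u by rewrite divr_ge0 ?mulr_ge0 // ltW.
rewrite sqrtrM // -/K sqrtrV // -/r natrM.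
rewrite [leLHS]mulrA ler_pdivrMr //.
apply: (@le_trans _ _ (q%:R * (e' * r) * K)).
  rewrite ler_wpM2r ?(ltW K_gt0) // ler_pM // ler_nat; exact: leq_pred.
have -> : q%:R * (e' * r) * K = e * r by rewrite /e'; field; rewrite ?gt_eqF.
by [].
Qed.

End Converse.

(** * Achievability *)

Definition letter_count (R : realType) (q n : nat) (b : 'I_q) (y : word q n) : R :=
  \sum_(i < n) (y i == b)%:R.

Definition expected_count (R : realType) (q n : nat) (U : 'M[R]_q)
    (x : word q n) (b : 'I_q) : R := \sum_(i < n) U (x i) b.

Definition typical (R : realType) (q n : nat) (c : 'I_q -> R) (t : R) :
    {set word q n} :=
  [set y | [forall b, `|letter_count R b y - c b| <= t]].

Lemma letter_count_perm (R : realType) (q n : nat) (b : 'I_q) (s : 'S_n)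
    (y : word q n) :
  letter_count R b (word_perm s y) = letter_count R b y.
Proof.
rewrite /letter_count [RHS](reindex_inj (@perm_inj _ s)) /=.
by apply: eq_bigr => i _; rewrite ffunE.
Qed.

(** Typicality depends only on letter counts, so averaging over permutations returns the indicator
    itself. *)
Lemma orbit_freq_typicalC (R : realType) (q n : nat) (c : 'I_q -> R) (t : R)
    (y : word q n) :
  orbit_freq R (~: typical n c t) y = (y \in ~: typical n c t)%:R.
Proof.
rewrite /orbit_freq (eq_bigr (fun=> (y \in ~: typical n c t)%:R)) => [|s _].
  by rewrite sumr_const card_Sn -[X in _ * X]mulr_natl mulKf // pnatr_eq0 -lt0n fact_gt0.
rewrite !inE; congr (~~ _)%:R; apply: eq_forallb => b.
by rewrite letter_count_perm.
Qed.

Lemma permch_ge0 (R : realType) (q n : nat) (U : 'M[R]_q) (x y : word q n) :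
  row_stochastic U -> 0 <= permch U x y.
Proof.
move=> [U0 _]; rewrite mulr_ge0 ?invr_ge0 // sumr_ge0 // => s _.
by apply: prodr_ge0 => i _; exact: U0.
Qed.

(** Chebyshev for each letter, the count being a sum of [n] independent indicators of variance at
    most 1, then a union bound over [q] letters. *)
Lemma typical_miss (R : realType) (q n : nat) (U : 'M[R]_q) (x : word q n) (t : R) :
  row_stochastic U -> 0 < t ->
  \sum_(y in ~: typical n (expected_count U x) t) permch U x y
  <= q%:R * n%:R / t ^+ 2.
Proof.
move=> Ustoch t_gt0; have [U0 U1] := Ustoch.
pose h b (i : 'I_n) (c : 'I_q) := (c == b)%:R - U (x i) b.
have hE b y : letter_count R b y - expected_count U x b =
    \sum_(i in [set: 'I_n]) h b i (y i).
  by rewrite -sumrB; apply: eq_bigl => i; rewrite inE.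
rewrite permch_sum; set A := ~: _.
apply: (@le_trans _ _ (\sum_(b < q) \sum_(y : word q n) (\prod_i U (x i) (y i)) *
    (\sum_(i in [set: 'I_n]) h b i (y i)) ^+ 2 / t ^+ 2)).
  rewrite exchange_big; apply: ler_sum => y _ /=.
  rewrite orbit_freq_typicalC; under [leRHS]eq_bigr do rewrite -mulrA.
  rewrite -mulr_sumr ler_wpM2l ?prodr_ge0 //.
  have nneg b : 0 <= (\sum_(i in [set: 'I_n]) h b i (y i)) ^+ 2 / t ^+ 2.
    by rewrite divr_ge0 ?sqr_ge0.
  have [|_] := boolP (y \in A); last by apply: sumr_ge0.
  rewrite !inE negb_forall => /existsP[b]; rewrite -ltNge hE => tlt.
  rewrite (bigD1 b) //= -[leLHS]addr0 lerD ?sumr_ge0 //.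
  rewrite ler_pdivlMr ?exprn_gt0 // mul1r -[leRHS](ger0_norm (sqr_ge0 _)) normrX.
  by rewrite lerXn2r ?nnegrE // ltW.
apply: (@le_trans _ _ (\sum_(b < q) n%:R / t ^+ 2)); last first.
  by rewrite sumr_const card_ord -[leLHS]mulr_natl mulrA.
apply: ler_sum => b _; rewrite -mulr_suml ler_wpM2r ?invr_ge0 ?sqr_ge0 //.
have hmean i : \sum_c U (x i) c * h b i c = 0.
  under eq_bigr do rewrite mulrBr.
  rewrite sumrB -mulr_suml U1 mul1r (bigD1 b) //= eqxx mulr1 big1 ?addr0 ?subrr //.
  by move=> c /negPf ->; rewrite mulr0.
rewrite (@prod_second_moment _ _ _ (fun i => U (x i)) (h b)) //.
apply: (@le_trans _ _ (\sum_(i in [set: 'I_n]) 1)); last first.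
  by rewrite sumr_const cardsT card_ord.
apply: ler_sum => i _; rewrite -[leRHS](U1 (x i)); apply: ler_sum => c _.
rewrite ler_piMr // /h.
have Ub : U (x i) b <= 1 by rewrite -(U1 (x i)) (bigD1 b) //= lerDl sumr_ge0.
by have := U0 (x i) b; case: (c == b) => /=; nra.
Qed.

Lemma word_of_counts (R : realType) (q n d : nat) (base : 'I_q)
    (a : 'I_d -> 'I_q) (c : 'I_d -> nat) :
  (\sum_l c l <= n)%N -> exists x : word q n, forall f : 'I_q -> R,
    \sum_i f (x i) = n%:R * f base + \sum_l (c l)%:R * (f (a l) - f base).
Proof.
move=> cn; pose t := flatten [seq nseq (c l) (a l) | l <- enum 'I_d].
have size_t : size t = (\sum_l c l)%N.
  rewrite size_flatten /shape -map_comp sumnE big_map big_enum.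
  by apply: eq_bigr => l _; rewrite /= size_nseq.
(* The default value of [nth] fills the positions past the end of [t] with [base]. *)
exists [ffun i : 'I_n => nth base t i] => f.
pose g b := f b - f base.
transitivity (\sum_(i < n) (f base + g (nth base t i))).
  by apply: eq_bigr => i _; rewrite ffunE /g; ring.
rewrite big_split /= sumr_const card_ord -[X in X + _]mulr_natl; congr (_ + _).
transitivity (\sum_(b <- t) g b).
  rewrite (big_nth base) -(big_mkord xpredT (fun i => g (nth base t i))).
  rewrite (big_cat_nat (n := size t)) ?size_t //= [X in _ + X]big_nat [X in _ + X]big1 ?addr0 //.
  by move=> i /andP[ti _]; rewrite nth_default ?size_t // /g subrr.
rewrite big_flatten big_map big_enum; apply: eq_bigr => l _ /=.
by rewrite big_nseq iter_addr_0 mulr_natl.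
Qed.

(** A maximal set of independent rows has a right inverse [V], which recovers [v] from the
    combination; the entries of [V] give [K]. *)
Lemma separating_rows (R : realType) (q : nat) (U : 'M[R]_q) :
  (0 < \rank U)%N ->
  exists (base : 'I_q) (a : 'I_(\rank U).-1 -> 'I_q) (K : R), 0 < K /\
    forall (v : 'I_(\rank U).-1 -> R) (t : R),
      (forall b, `|\sum_l v l * (U (a l) b - U base b)| <= t) ->
      forall l, `|v l| <= K * t.
Proof.
move=> r_gt0; pose f := maxrankfun U; pose l0 := Ordinal r_gt0.
pose B := rowsub f U; pose V := pinvmx B.
have BV : B *m V = 1%:M by apply: mulmxVp; exact: maxrowsub_free.
pose K := 1 + \sum_i \sum_j `|V i j|.
exists (f l0), (fun l => f (lift l0 l)), K.
have K_gt0 : 0 < K by rewrite ltr_pwDl // sumr_ge0 // => i _; exact: sumr_ge0.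
split=> // v t vt l.
(* Giving the base row minus the sum of the [v j] turns a combination of row differences into one of
   the rows themselves. *)
pose ext : 'rV[R]_(\rank U) :=
  \row_i (if unlift l0 i is Some j then v j else - \sum_j v j).
have extB b : (ext *m B) 0 b = \sum_l v l * (U (f (lift l0 l)) b - U (f l0) b).
  rewrite mxE (bigD1_ord l0) //= !mxE unlift_none.
  under eq_bigr do rewrite !mxE liftK.
  under [RHS]eq_bigr do rewrite mulrBr.
  by rewrite sumrB -mulr_suml; ring.
have vE : v l = \sum_b (ext *m B) 0 b * V b (lift l0 l).
  have : (ext *m B *m V) 0 (lift l0 l) = v l.
    by rewrite -mulmxA BV mulmx1 mxE liftK.
  by rewrite mxE => <-.
have t_ge0 : 0 <= t by exact: le_trans (vt (f l0)).
rewrite vE (le_trans (ler_norm_sum _ _ _)) //.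
apply: (@le_trans _ _ (\sum_b t * `|V b (lift l0 l)|)).
  by apply: ler_sum => b _; rewrite normrM extB ler_wpM2r.
rewrite -mulr_sumr mulrC ler_wpM2r //.
apply: (@le_trans _ _ (\sum_i \sum_j `|V i j|)); last by rewrite lerDr.
by apply: ler_sum => b _; rewrite (bigD1 (lift l0 l)) //= lerDl sumr_ge0.
Qed.

Lemma log2_ge1 (R : realType) (n : nat) : (2 <= n)%N -> 1 <= log2 (n%:R : R).
Proof.
move=> n2; rewrite /log2 ler_pdivlMr ?ln_gt0 ?ltr1n // mul1r.
by rewrite ler_ln ?posrE ?ltr0n ?ler_nat // (leq_trans _ n2).
Qed.

Lemma typical_disjoint (R : realType) (q n : nat) (c c' : 'I_q -> R) (t : R)
    (y : word q n) :
  y \in typical n c t -> y \in typical n c' t -> forall b, `|c b - c' b| <= 2 * t.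
Proof.
rewrite !inE => /forallP yc /forallP yc' b; have := yc b; have := yc' b.
by rewrite !ler_norml; lra.
Qed.

Lemma achievability_bound (R : realType) (q : nat) (U : 'M[R]_q) :
  row_stochastic U -> (0 < \rank U)%N ->
  exists2 c : R, 0 < c & forall n, (2 <= n)%N ->
    exists (L : nat) (C : idcode (word q n) (word q n) L),
    [/\ (n%:R / (c * log2 (n%:R : R))) `^ (((\rank U)%:R - 1) / 2) <= L%:R,
        lambda1 (permch U) C <= q%:R / log2 (n%:R : R) &
        lambda2 (permch U) C <= q%:R / log2 (n%:R : R)].
Proof.
move=> Ustoch r_gt0; have [base [a [K [K_gt0 Ksep]]]] := separating_rows r_gt0.
set d := (\rank U).-1 in a Ksep *.
(* Chosen so that [d] letters, each used at most [m * s] times, fit into length [n]; the added 1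
   keeps it positive when [d = 0]. *)
pose gam := d%:R * (2 * K + 1) + 1.
have gam_gt0 : 0 < gam by rewrite ltr_wpDl // mulr_ge0 // addr_ge0 // mulr_ge0 // ltW.
exists (gam ^+ 2); first by rewrite exprn_gt0.
move=> n n_ge2; set l := log2 _.
have l_ge1 : 1 <= l by exact: log2_ge1.
have l_gt0 : 0 < l by exact: lt_le_trans l_ge1.
have n_ge1 : 1 <= n%:R :> R by rewrite ler1n (leq_trans _ n_ge2).
(* At this radius the Chebyshev bound [q * n / T ^+ 2] equals [q / l]. *)
pose T := Num.sqrt (n%:R * l).
have T2 : T ^+ 2 = n%:R * l by rewrite sqr_sqrtr // mulr_ge0 // ltW.
have T_ge1 : 1 <= T by rewrite -sqrtr1 ler_wsqrtr // -[leLHS]mulr1 ler_pM.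
have T_gt0 : 0 < T by exact: lt_le_trans T_ge1.
pose s := (Num.trunc (2 * K * T)).+1.
have KT_ge0 : 0 <= 2 * K * T by rewrite !mulr_ge0 // ltW.
have s_gt : 2 * K * T < s%:R by exact: truncnS_gt.
have s_le : s%:R <= (2 * K + 1) * T.
  by rewrite /s -[leLHS]natr1 [leRHS]mulrDl mul1r lerD // truncn_le.
(* The required size is [z] to the power [d]; each coordinate has [m.+1 > z] values. *)
pose z := Num.sqrt (n%:R / (gam ^+ 2 * l)).
have zE : z = n%:R / (gam * T).
  have h0 : 0 <= n%:R / (gam * T) by rewrite divr_ge0 // mulr_ge0 // ltW.
  rewrite -[RHS]ger0_norm // -sqrtr_sqr /z; congr Num.sqrt.
  rewrite expr_div_n exprMn T2; field.
  by rewrite !gt_eqF // (lt_le_trans ltr01).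
have z_ge0 : 0 <= z by exact: sqrtr_ge0.
pose m := Num.trunc z.
have m_le : m%:R <= z by rewrite truncn_le.
pose code := {ffun 'I_d -> 'I_m.+1}.
have fits (k : code) : (\sum_j k j * s <= n)%N.
  apply: (@leq_trans (\sum_(j < d) m * s)%N).
    by apply: leq_sum => j _; rewrite leq_mul2r -ltnS ltn_ord orbT.
  rewrite sum_nat_const card_ord -(ler_nat R) !natrM.
  apply: (@le_trans _ _ (d%:R * (z * ((2 * K + 1) * T)))).
    by rewrite ler_wpM2l // ler_pM.
  have -> : d%:R * (z * ((2 * K + 1) * T)) = n%:R * ((d%:R * (2 * K + 1)) / gam).
    by rewrite zE; field; rewrite !gt_eqF.
  rewrite -[leRHS]mulr1 ler_wpM2l // ler_pdivrMr // mul1r /gam lerDl //.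
have [x xE] := choice (fun k : code => @word_of_counts R q n d base a _ (fits k)).
pose D (k : code) := typical n (expected_count U (x k)) T.
pose C : idcode (word q n) (word q n) #|code| :=
  IdCode (fun i => x (enum_val i)) (fun i => D (enum_val i)).
(* A common typical output puts the expected counts within [2 * T], so separation gives
   [|k j - k' j| * s <= 2 * K * T < s]. *)
have D_disj (k k' : code) y : y \in D k -> y \in D k' -> k = k'.
  move=> yk yk'; apply/ffunP => j; apply/eqP/negPn/negP => kk'.
  pose v j := ((k j)%:R - (k' j)%:R) * s%:R : R.
  have vsmall b : `|\sum_j v j * (U (a j) b - U base b)| <= 2 * T.
    have := typical_disjoint yk yk' b; rewrite /expected_count.
    rewrite (xE k (fun e => U e b)) (xE k' (fun e => U e b)).
    congr (`|_| <= _); rewrite opprD addrACA subrr add0r -sumrB.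
    by apply: eq_bigr => e _; rewrite /v !natrM; ring.
  have := Ksep v (2 * T) vsmall j; rewrite /v normrM (ger0_norm (ler0n _ s)).
  have vj_ge1 : 1 <= `|(k j)%:R - (k' j)%:R| :> R.
    have : (k j != k' j :> nat) by [].
    rewrite neq_ltn => /orP[lt|lt]; last first.
      by rewrite ger0_norm ?subr_ge0 ?ler_nat 1?ltnW // -natrB ?ler1n ?subn_gt0 // ltnW.
    rewrite distrC ger0_norm ?subr_ge0 ?ler_nat 1?ltnW // -natrB ?ler1n ?subn_gt0 //.
    exact: ltnW.
  apply/negP; rewrite -ltNge mulrCA mulrA (lt_le_trans s_gt) //.
  by rewrite ler_peMl.
have missD i : lam_miss (permch U) C i <= q%:R / l.
  apply: le_trans (typical_miss (x (enum_val i)) Ustoch T_gt0) _.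
  have -> : q%:R / l = q%:R * n%:R / (n%:R * l).
    by field; rewrite !gt_eqF // (lt_le_trans ltr01).
  by rewrite T2.
have ql_ge0 : 0 <= q%:R / l by rewrite divr_ge0 // ltW.
exists #|code|, C; split.
- have dE : ((\rank U)%:R - 1) / 2 = 2^-1 * d%:R :> R.
    by rewrite -[in LHS](prednK r_gt0) -natr1 addrK mulrC.
  rewrite dE powRrM powR12_sqrt; last by rewrite divr_ge0 // mulr_ge0 ?sqr_ge0 // ltW.
  rewrite powR_mulrn // -/z card_ffun !card_ord natrX lerXn2r ?nnegrE //.
  by rewrite ltW // truncnS_gt.
- by apply: bigmax_le.
- apply: bigmax_le => // i _; apply: bigmax_le => // j ji.
  (* Disjointness puts the decoding set of [j] inside the complement of that of [i], so the cross
     error is at most the miss at [i]. *)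
  apply: le_trans (missD i).
  rewrite /lam_cross /lam_miss big_mkcond [leRHS]big_mkcond; apply: ler_sum => y _.
  case: ifPn => yj; case: ifPn => // yi; first last.
  + exact: permch_ge0.
  + case/negP: ji; rewrite finset.in_setC negbK in yi.
    by apply/eqP/enum_val_inj; exact: D_disj yj yi.
Qed.

(** * Asymptotics *)

Local Open Scope classical_set_scope.
Local Open Scope ring_scope.

Lemma limn_einf_ge (R : realType) (u : nat -> \bar R) (a : \bar R) :
  (\forall i \near \oo, (a <= u i)%E) -> (a <= limn_einf u)%E.
Proof.
move=> au; rewrite -[limn_einf u]/(limf_einf u \oo) limf_einfE.
apply: (@le_trans _ _ (ereal_inf [set u i | i in [set i | (a <= u i)%E]])).
  by apply: le_ereal_inf_tmp => _ [i ai <-].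
by apply: ereal_sup_ubound; exists [set i | (a <= u i)%E].
Qed.

Lemma cvg_log2_pinfty (R : realType) : log2 (n%:R : R) @[n --> \oo] --> +oo.
Proof.
apply/cvgryPge => A; near=> n.
have n_gt0 : 0 < n%:R :> R by near: n; exact: nbhs_infty_gtr.
rewrite /log2 ler_pdivlMr ?ln_gt0 ?ltr1n //.
rewrite -[leLHS]expRK ler_ln ?posrE ?expR_gt0 //.
near: n; exact: nbhs_infty_ger.
Unshelve. all: by end_near. Qed.

(** The power of the logarithm is at least 1 once [n i >= 2], so the assumed size exceeds the
    threshold of [converse_bound]. *)
Lemma converse_near (R : realType) (q : nat) (M : R) (n : nat -> nat)
    (c : nat -> R) (L : nat -> nat) :
  0 < M -> n @ \oo --> \oo -> (\forall i \near \oo, M < c i) ->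
  (forall i, c i * (n i)%:R `^ ((q%:R - 1) / 2)
     * log2 ((n i)%:R : R) ^+ ((q.-1 * q.-2) %/ 2)%N <= (L i)%:R) ->
  (0 < q)%N ->
  \forall i \near \oo, (0 < n i)%N /\ M * Num.sqrt (n i)%:R ^+ q.-1 < (L i)%:R.
Proof.
move=> M_gt0 ncvg Mc hL q_gt0; near=> i.
have n2 : (2 <= n i)%N by near: i; exact: (ncvg _ (nbhs_infty_ge 2)).
have n_gt0 : (0 < n i)%N by exact: leq_trans n2.
split=> //; apply: lt_le_trans (hL i).
have -> : (n i)%:R `^ ((q%:R - 1) / 2) = Num.sqrt (n i)%:R ^+ q.-1 :> R.
  have -> : (q%:R - 1) / 2 = 2^-1 * q.-1%:R :> R.
    by rewrite -[in LHS](prednK q_gt0) -natr1 addrK mulrC.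
  by rewrite powRrM powR12_sqrt // powR_mulrn.
have s_gt0 : 0 < Num.sqrt (n i)%:R ^+ q.-1 :> R.
  by rewrite exprn_gt0 // sqrtr_gt0 ltr0n.
have Mci : M < c i by near: i.
apply: (@lt_le_trans _ _ (c i * Num.sqrt (n i)%:R ^+ q.-1)).
  by rewrite ltr_pM2r.
rewrite ler_peMr ?exprn_ege1 ?log2_ge1 // mulr_ge0 ?sqrtr_ge0 //.
by rewrite ltW // (lt_trans M_gt0).
Unshelve. all: by end_near. Qed.

Lemma uniform_lower_bound (R : realType) (q : nat) (U : 'M[R]_q) :
  (forall a b, 0 < U a b) -> exists2 u : R, 0 < u & forall a b, u <= U a b.
Proof.
move=> U_gt0; exists (\big[Num.min/1]_a \big[Num.min/1]_b U a b).
  by do 2 (apply: lt_bigmin => // ? _).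
by move=> a b; do 2 (apply: bigmin_inf => //).
Qed.

Lemma lambda1_ge0 (R : realType) (A B : finType) (W : A -> B -> R) (L : nat)
    (C : idcode A B L) : 0 <= lambda1 W C.
Proof. exact: bigmax_ge_id. Qed.

Lemma lambda2_ge0 (R : realType) (A B : finType) (W : A -> B -> R) (L : nat)
    (C : idcode A B L) : 0 <= lambda2 W C.
Proof. exact: bigmax_ge_id. Qed.

Theorem theorem3 (R : realType) (q : nat) (U : 'M[R]_q) :
  (2 <= q)%N -> row_stochastic U ->
  (* (i) achievability *)
  (exists c : R, 0 < c /\
     exists (L : nat -> nat) (C : forall n, idcode (word q n) (word q n) (L n)),
       (forall n : nat, (2 <= n)%N ->
          ((n%:R / (c * log2 (n%:R : R))) `^ (((\rank U)%:R - 1) / 2)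
             <= (L n)%:R)) /\
       lambda1 (@permch R q n U) (C n) @[n --> \oo] --> (0:R) /\
       lambda2 (@permch R q n U) (C n) @[n --> \oo] --> (0:R)) /\
  ((forall a b, 0 < U a b) ->
  (* (ii) weak converse *)
   (exists R' : R, forall Rt : R, R' < Rt ->
     forall (n : nat -> nat), n @ \oo --> \oo ->
     forall (L : nat -> nat)
            (C : forall i, idcode (word q (n i)) (word q (n i)) (L i)),
       (forall i, Rt * (n i)%:R `^ ((q%:R - 1) / 2)
                    * log2 ((n i)%:R : R) ^+ ((q.-1 * q.-2) %/ 2)%N
                  <= (L i)%:R) ->
       (0 < limn_einf (fun i => (lambda1 (@permch R q (n i) U) (C i)
                                + lambda2 (@permch R q (n i) U) (C i))%:E))%E)
   /\
  (* (iii) strong converse *)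
   (forall (n : nat -> nat) (c : nat -> R),
     n @ \oo --> \oo -> c @ \oo --> +oo ->
     forall (L : nat -> nat)
            (C : forall i, idcode (word q (n i)) (word q (n i)) (L i)),
       (forall i, c i * (n i)%:R `^ ((q%:R - 1) / 2)
                    * log2 ((n i)%:R : R) ^+ ((q.-1 * q.-2) %/ 2)%N
                  <= (L i)%:R) ->
       (1 <= limn_einf (fun i => (lambda1 (@permch R q (n i) U) (C i)
                                + lambda2 (@permch R q (n i) U) (C i))%:E))%E)).
Proof.
move=> q_ge2 Ustoch; have q_gt0 : (0 < q)%N by exact: leq_trans q_ge2.
split.
  have r_gt0 : (0 < \rank U)%N.
    rewrite lt0n mxrank_eq0; apply/eqP => U0.
    have := proj2 Ustoch (Ordinal q_gt0); rewrite big1 => [|b _]; last by rewrite U0 mxE.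
    by move/eqP; rewrite eq_sym oner_eq0.
  have [c c_gt0 codes] := achievability_bound Ustoch r_gt0.
  exists c; split=> //.
  (* Size and code are packed in one dependent pair so that choice applies; below [n = 2] a one-word
     code serves as filler. *)
  have code_ex (n : nat) : exists LC : {L & idcode (word q n) (word q n) L},
      (2 <= n)%N ->
      [/\ (n%:R / (c * log2 (n%:R : R))) `^ (((\rank U)%:R - 1) / 2) <= (tag LC)%:R,
          lambda1 (permch U) (tagged LC) <= q%:R / log2 (n%:R : R) &
          lambda2 (permch U) (tagged LC) <= q%:R / log2 (n%:R : R)].
    have [/codes[L [C LC]]|_] := leqP 2 n; first by exists (existT _ L C).
    by exists (existT _ 1%N (IdCode (fun=> [ffun=> Ordinal q_gt0]) (fun=> finset.set0))).
  pose LC n := sval (cid (code_ex n)).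
  have LCP n := svalP (cid (code_ex n)); rewrite -/(LC _) in LCP.
  have bound_cvg0 : q%:R / log2 (n%:R : R) @[n --> \oo] --> (0 : R).
    rewrite -(mulr0 q%:R); apply: cvgMl_tmp.
    apply/(gtr0_cvgV0 (f := fun n => log2 (n%:R : R))); last exact: cvg_log2_pinfty.
    near=> n; apply: lt_le_trans ltr01 (log2_ge1 _ _).
    by near: n; exact: nbhs_infty_ge.
  exists (fun n => tag (LC n)), (fun n => tagged (LC n)); split; last split.
  - by move=> n /LCP[].
  - apply: (squeeze_cvgr _ (cvg_cst 0) bound_cvg0); near=> n.
    have /LCP[_ -> _] : (2 <= n)%N by near: n; exact: nbhs_infty_ge.
    by rewrite lambda1_ge0.
  - apply: (squeeze_cvgr _ (cvg_cst 0) bound_cvg0); near=> n.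
    have /LCP[_ _ ->] : (2 <= n)%N by near: n; exact: nbhs_infty_ge.
    by rewrite lambda2_ge0.
move=> /uniform_lower_bound[u u_gt0 Uu]; split.
  (* With [e = 1 / 2] the error sum is eventually at least [1 / 2], and [M] serves as [R']. *)
  have [M M_gt0 MP] := converse_bound q_gt0 Ustoch u_gt0 Uu (e := 1 / 2) ltac:(lra).
  exists M => Rt MRt n ncvg L C hL.
  apply: (@lt_le_trans _ _ (1 / 2)%:E); first by rewrite lte_fin; lra.
  apply: limn_einf_ge.
  have Mc : \forall i \near \oo, M < (fun=> Rt) (i : nat) by exact: nearW.
  apply: filterS (converse_near M_gt0 ncvg Mc hL q_gt0) => i [n_gt0 Li].
  rewrite lee_fin.
  by apply: le_trans (MP _ _ (C i) n_gt0 Li); lra.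
(* Here [e] is arbitrary: [c i] eventually exceeds whatever [M] belongs to it. *)
move=> n c ncvg ccvg L C hL; apply/lee_subgt0Pr => e e_gt0.
have [M M_gt0 MP] := converse_bound q_gt0 Ustoch u_gt0 Uu e_gt0.
rewrite -EFinB; apply: limn_einf_ge.
have Mc : \forall i \near \oo, M < c i by move/cvgryPgt : ccvg; exact.
apply: filterS (converse_near M_gt0 ncvg Mc hL q_gt0) => i [n_gt0 Li].
by rewrite lee_fin; exact: MP.
Unshelve. all: by end_near. Qed.
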